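(* Let $\mathcal{X}$ be a finite nonempty set. The strong topology $\mathcal{T}_{s,\mathcal{X},\ast}^{(o)}$ on $\mathrm{DMC}_{\mathcal{X},\ast}^{(o)}$ is a natural topology, and it is the finest natural topology: every natural topology $\mathcal{T}$ on $\mathrm{DMC}_{\mathcal{X},\ast}^{(o)}$ satisfies $\mathcal{T}\subset\mathcal{T}_{s,\mathcal{X},\ast}^{(o)}$.
   Context: For finite nonempty sets $\mathcal{X},\mathcal{Y}$, $\mathrm{DMC}_{\mathcal{X},\mathcal{Y}}$ is the set of channels from $\mathcal{X}$ to $\mathcal{Y}$, i.e. functions $W:\mathcal{X}\times\mathcal{Y}\to[0,1]$, written $W(y|x)$, with $\sum_{y\in\mathcal{Y}}W(y|x)=1$ for every $x\in\mathcal{X}$. It carries the topology $\mathcal{T}_{\mathcal{X},\mathcal{Y}}$ inherited from the Euclidean topology of $\mathbb{R}^{\mathcal{X}\times\mathcal{Y}}$. For $W\in\mathrm{DMC}_{\mathcal{X},\mathcal{Y}}$ and $V\in\mathrm{DMC}_{\mathcal{Y},\mathcal{Z}}$, the composition $V\circ W\in\mathrm{DMC}_{\mathcal{X},\mathcal{Z}}$ is $(V\circ W)(z|x)=\sum_{y\in\mathcal{Y}}V(z|y)W(y|x)$. A channel $W'\in\mathrm{DMC}_{\mathcal{X},\mathcal{Z}}$ is degraded from $W\in\mathrm{DMC}_{\mathcal{X},\mathcal{Y}}$ if $W'=V\circ W$ for some $V\in\mathrm{DMC}_{\mathcal{Y},\mathcal{Z}}$; $W$ and $W'$ are equivalent if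 each is degraded from the other. $\mathrm{DMC}_{\mathcal{X},\mathcal{Y}}^{(o)}$ is the quotient of $\mathrm{DMC}_{\mathcal{X},\mathcal{Y}}$ by this equivalence relation, with the quotient topology $\mathcal{T}_{\mathcal{X},\mathcal{Y}}^{(o)}$. Let $[n]=\{1,\dots,n\}$, let $\mathrm{DMC}_{\mathcal{X},\ast}=\coprod_{n\ge1}\mathrm{DMC}_{\mathcal{X},[n]}$, and let $\mathrm{DMC}_{\mathcal{X},\ast}^{(o)}$ be the quotient set of $\mathrm{DMC}_{\mathcal{X},\ast}$ by equivalence of channels. For each $n\geq 1$, $\mathrm{DMC}_{\mathcal{X},[n]}^{(o)}$ is identified with the subset of $\mathrm{DMC}_{\mathcal{X},\ast}^{(o)}$ consisting of the classes containing a channel with output alphabet $[n]$; these subsets increase with $n$ and their union is $\mathrm{DMC}_{\mathcal{X},\ast}^{(o)}$. A topology on $\mathrm{DMC}_{\mathcal{X},\ast}^{(o)}$ is called natural if for every $n\ge1$ the subspace topology it induces on $\mathrm{DMC}_{\mathcal{X},[n]}^{(o)}$ is $\mathcal{T}_{\mathcal{X},[n]}^{(o)}$. The strong topology $\mathcal{T}_{s,\mathcal{X},\ast}^{(o)}$ is the quotient topology on $\mathrm{DMC}_{\mathcal{X},\ast}^{(o)}$ of the disjoint union topology $\bigoplus_{n\ge1}\mathcal{T}_{\mathcal{X},[n]}$ on $\mathrm{DMC}_{\mathcal{X},\ast}$. *)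

(* Defs.v *)
From HB Require Import structures.
From mathcomp Require Import all_boot all_order all_algebra.
From mathcomp Require Import generic_quotient.
From mathcomp Require Import all_classical all_reals all_analysis.

Set Implicit Arguments.
Unset Strict Implicit.
Unset Printing Implicit Defensive.

Import Order.TTheory GRing.Theory Num.Theory.
Import numFieldNormedType.Exports.

Local Open Scope classical_set_scope.
Local Open Scope ring_scope.
Local Open Scope quotient_scope.

Section channels.
Variable R : realType.

(* The product topology carried by [{ptws X * Y -> R}] is the Euclidean one,
   since X * Y is finite. *)
Definition channel_set (X Y : finType) : set {ptws X * Y -> R} :=
  [set W | (forall x y, 0 <= W (x, y) <= 1) /\
           (forall x, \sum_(y : Y) W (x, y) = 1)].
Arguments channel_set : clear implicits.

(* [set_type] carries the topology induced by the ambient space. *)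
Definition DMC (X Y : finType) : topologicalType := set_type (channel_set X Y).

Definition prob (X Y : finType) (W : DMC X Y) (y : Y) (x : X) : R :=
  set_val W (x, y).

Lemma prob_ge0 X Y (W : DMC X Y) y x : 0 <= prob W y x.
Proof. by case: (set_valP W) => /(_ x y)/andP[]. Qed.

Lemma prob_sum1 X Y (W : DMC X Y) x : \sum_y prob W y x = 1.
Proof. by case: (set_valP W) => _ /(_ x). Qed.

Lemma channel_setP (X Y : finType) (f : X * Y -> R) :
  (forall x y, 0 <= f (x, y)) ->
  (forall x, \sum_y f (x, y) = 1) -> channel_set X Y f.
Proof.
move=> f0 f1; split=> // x y; rewrite f0 -(f1 x) (bigD1 y)//= lerDl.
exact: sumr_ge0.
Qed.

Lemma prob_inj X Y (W W' : DMC X Y) : prob W =2 prob W' -> W = W'.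
Proof. by move=> WW'; apply: val_inj; apply/funext => -[x y]; exact: WW'. Qed.

Definition comp_fun X Y Z (V : DMC Y Z) (W : DMC X Y) : {ptws X * Z -> R} :=
  fun xz => \sum_(y : Y) prob V xz.2 y * prob W y xz.1.

Lemma comp_fun_channel X Y Z (V : DMC Y Z) (W : DMC X Y) :
  channel_set X Z (comp_fun V W).
Proof.
apply: channel_setP => [x z|x]; rewrite /comp_fun /=.
  by apply: sumr_ge0 => y _; rewrite mulr_ge0 ?prob_ge0.
rewrite exchange_big /= -(prob_sum1 W x); apply: eq_bigr => y _.
by rewrite -mulr_suml prob_sum1 mul1r.
Qed.

Definition dmc_comp X Y Z (V : DMC Y Z) (W : DMC X Y) : DMC X Z :=
  SigSub (mem_set (comp_fun_channel V W)).

Lemma prob_comp X Y Z (V : DMC Y Z) (W : DMC X Y) z x :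
  prob (dmc_comp V W) z x = \sum_y prob V z y * prob W y x.
Proof. by rewrite /prob set_valE. Qed.

Definition degraded X Y Z (W' : DMC X Z) (W : DMC X Y) : Prop :=
  exists V : DMC Y Z, W' = dmc_comp V W.

Definition equivalent X Y Z (W : DMC X Y) (W' : DMC X Z) : Prop :=
  degraded W' W /\ degraded W W'.

Lemma id_channel X : channel_set X X (fun xy => (xy.1 == xy.2)%:R).
Proof.
apply: channel_setP => [x y|x] /=; first exact: ler0n.
by rewrite (bigD1 x)//= eqxx big1 ?addr0// => y /negbTE; rewrite eq_sym => ->.
Qed.

Definition dmc_id X : DMC X X := SigSub (mem_set (id_channel X)).

Lemma prob_id (X : finType) (y x : X) : prob (dmc_id X) y x = (x == y)%:R.
Proof. by rewrite /prob set_valE. Qed.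

Lemma degraded_refl X Y (W : DMC X Y) : degraded W W.
Proof.
exists (dmc_id Y); apply: prob_inj => y x; rewrite prob_comp.
rewrite (bigD1 y)//= big1 ?addr0 => [|z /negbTE zy]; rewrite prob_id.
  by rewrite eqxx mul1r.
by rewrite zy mul0r.
Qed.

Lemma degraded_trans X Y1 Y2 Y3 (W1 : DMC X Y1) (W2 : DMC X Y2)
  (W3 : DMC X Y3) : degraded W1 W2 -> degraded W2 W3 -> degraded W1 W3.
Proof.
move=> [V ->] [V' ->]; exists (dmc_comp V V'); apply: prob_inj => y x.
rewrite !prob_comp; under eq_bigr do rewrite prob_comp mulr_sumr.
rewrite exchange_big /=; apply: eq_bigr => z _.
by rewrite prob_comp mulr_suml; apply: eq_bigr => t _; rewrite mulrA.
Qed.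

Lemma equivalent_refl X Y (W : DMC X Y) : equivalent W W.
Proof. by split; exact: degraded_refl. Qed.

Lemma equivalent_sym X Y Z (W : DMC X Y) (W' : DMC X Z) :
  equivalent W W' -> equivalent W' W.
Proof. by case. Qed.

Lemma equivalent_trans X Y1 Y2 Y3 (W1 : DMC X Y1) (W2 : DMC X Y2)
  (W3 : DMC X Y3) : equivalent W1 W2 -> equivalent W2 W3 -> equivalent W1 W3.
Proof.
move=> [d21 d12] [d32 d23].
by split; [exact: degraded_trans d21 | exact: degraded_trans d23].
Qed.

Section fixed_output.
Variables X Y : finType.

Definition dmc_eqv : rel (DMC X Y) := fun W W' => `[< equivalent W W' >].

Lemma dmc_eqv_refl : reflexive dmc_eqv.
Proof. by move=> W; apply/asboolP; exact: equivalent_refl. Qed.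

Lemma dmc_eqv_sym : symmetric dmc_eqv.
Proof. by move=> W W'; apply/asboolP/asboolP; exact: equivalent_sym. Qed.

Lemma dmc_eqv_trans : transitive dmc_eqv.
Proof.
move=> V W W' /asboolP WV /asboolP VW'; apply/asboolP.
exact: equivalent_trans WV VW'.
Qed.

Canonical dmc_equiv_rel :=
  EquivRel dmc_eqv dmc_eqv_refl dmc_eqv_sym dmc_eqv_trans.

Definition DMCo : topologicalType := quotient_topology {eq_quot dmc_eqv}.

Definition DMCo_class (W : DMC X Y) : DMCo := \pi_({eq_quot dmc_eqv}) W.

End fixed_output.

Section any_output.
Variable X : finType.

(* The alphabet [n], n >= 1, is represented by 'I_m.+1 where n = m.+1.
   The type [{m & _}] carries the disjoint union topology. *)
Definition DMCs : topologicalType := {m : nat & DMC X 'I_m.+1}.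

Definition dmcs_eqv : rel DMCs :=
  fun W W' => `[< equivalent (projT2 W) (projT2 W') >].

Lemma dmcs_eqv_refl : reflexive dmcs_eqv.
Proof. by move=> W; apply/asboolP; exact: equivalent_refl. Qed.

Lemma dmcs_eqv_sym : symmetric dmcs_eqv.
Proof. by move=> W W'; apply/asboolP/asboolP; exact: equivalent_sym. Qed.

Lemma dmcs_eqv_trans : transitive dmcs_eqv.
Proof.
move=> V W W' /asboolP WV /asboolP VW'; apply/asboolP.
exact: equivalent_trans WV VW'.
Qed.

Canonical dmcs_equiv_rel :=
  EquivRel dmcs_eqv dmcs_eqv_refl dmcs_eqv_sym dmcs_eqv_trans.

(* The bare quotient set, without a preferred topology. *)
Definition DMCso : Type := {eq_quot dmcs_eqv}.

Definition DMCso_class m (W : DMC X 'I_m.+1) : DMCso :=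
  \pi_({eq_quot dmcs_eqv}) (existT _ m W : DMCs).

Definition DMCso_sub (m : nat) : set DMCso :=
  [set c | exists W : DMC X 'I_m.+1, c = DMCso_class W].

(* The identification of DMCo X 'I_m.+1 with DMCso_sub m; see DMCo_inclE,
   DMCo_incl_inj and DMCo_incl_range below. *)
Definition DMCo_incl (m : nat) (c : DMCo X 'I_m.+1) : DMCso :=
  DMCso_class (repr (c : {eq_quot @dmc_eqv X 'I_m.+1})).

Lemma DMCo_classP m (W W' : DMC X 'I_m.+1) :
  DMCo_class W = DMCo_class W' <-> equivalent W W'.
Proof. by split => [/eqmodP/asboolP//|e]; apply/eqmodP/asboolP. Qed.

Lemma DMCso_classP m k (W : DMC X 'I_m.+1) (W' : DMC X 'I_k.+1) :
  DMCso_class W = DMCso_class W' <-> equivalent W W'.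
Proof. by split => [/eqmodP/asboolP//|e]; apply/eqmodP/asboolP. Qed.

Lemma DMCo_class_repr m (c : DMCo X 'I_m.+1) :
  DMCo_class (repr (c : {eq_quot @dmc_eqv X 'I_m.+1})) = c.
Proof. exact: reprK. Qed.

Lemma DMCo_inclE m (W : DMC X 'I_m.+1) :
  DMCo_incl (DMCo_class W) = DMCso_class W.
Proof. by apply/DMCso_classP/DMCo_classP; rewrite DMCo_class_repr. Qed.

Lemma DMCo_incl_inj m : injective (@DMCo_incl m).
Proof.
move=> c d /DMCso_classP/DMCo_classP.
by rewrite !DMCo_class_repr.
Qed.

Lemma DMCo_incl_range m : range (@DMCo_incl m) = DMCso_sub m.
Proof.
apply/seteqP; split=> [_ [c _ <-]|_ [W ->]]; first by eexists.
by exists (DMCo_class W) => //; rewrite DMCo_inclE.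
Qed.

(* A topology on the set S is a term of type [Topological S]. *)
Definition opens (S : Type) (T : Topological S) : set (set S) :=
  @open (Topological.Pack T).

Definition subspace_opens (S : Type) (T : Topological S) (A : set S) :
    set (set S) :=
  [set U `&` A | U in opens T].

Definition natural_topology (T : Topological DMCso) : Prop :=
  forall m : nat,
    subspace_opens T (DMCso_sub m) =
    [set (@DMCo_incl m) @` U | U in (open : set (set (DMCo X 'I_m.+1)))].

Definition strong_topology : Topological DMCso :=
  Topological.class (quotient_topology {eq_quot dmcs_eqv}).

End any_output.
End channels.

(* Main.v *)
Require Import Defs.
From HB Require Import structures.
From mathcomp Require Import all_boot all_order all_algebra.
From mathcomp Require Import all_classical all_reals all_analysis.

Set Implicit Arguments.
Unset Strict Implicit.
Unset Printing Implicit Defensive.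

Import Order.TTheory GRing.Theory Num.Theory.
Import numFieldNormedType.Exports.

Local Open Scope classical_set_scope.
Local Open Scope ring_scope.

(** A natural topology traces open sets on every [DMCo X 'I_m.+1], so its open
sets have open preimages in every [DMC X 'I_m.+1] and are strongly open.  That
the strong topology is itself natural amounts to extending an open set [V] of
the [m]-th piece to a strongly open set; the complement of the image of [~` V]
works, provided that image is strongly closed.  Its preimage in
[DMC X 'I_n.+1] consists of the [W] for which there are a channel [W'] in a
closed set and two degrading channels [V1], [V2] with [W = V1 W'] and
[W' = V2 W].  These are closed conditions and [W'], [V1], [V2] range over
compact spaces, so the projection to [W] is closed. *)

(** Tube lemma: if the fibre of [K] over [t] is empty, compactness of [U] turns the local
    neighbourhoods avoiding [K] into one neighbourhood of [t] valid for all [u]. *)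
Lemma closed_fst_image (T U : topologicalType) (K : set (T * U)) :
  compact [set: U] -> closed K -> closed (fst @` K).
Proof.
move=> /compact_near_coveringP cU cK; rewrite -openC openE => t Kt.
have : \forall t' \near t, [set: U] `<=` [set u | ~ K (t', u)].
  apply: (cU _ _ (fun t' u => ~ K (t', u))) => u _.
  have : nbhs (t, u) (~` K).
    apply: open_nbhs_nbhs; split; first exact: closed_openC.
    by move=> Ktu; apply: Kt; exists (t, u).
  case=> -[A B] [/= At Bu] AB; exists (B, A) => // -[u' t'] [Bu' At'].
  exact: AB.
by apply: filterS => t' K't [[t'' u] Ku /= e]; apply: (K't u) => //; rewrite -e.
Qed.

(** Push the filter forward along [set_val]. A cluster point in [A] lifts back because open sets of
    the subspace are preimages of open sets of [T]. *)
Lemma compact_set_type (T : topologicalType) (A : set T) :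
  compact A -> compact [set: set_type A].
Proof.
move=> cA F FF _; pose G := fmap set_val F.
have [|a [Aa Ga]] := cA G _.
  by rewrite /G /fmap /=; apply: filterS filterT => x _; exact: set_valP.
exists (SigSub (mem_set Aa)); split => // B C FB [_ [[D oD <-] /= Da] DC].
have [_ [[b Bb <-] Db]] : (set_val @` B) `&` D !=set0.
  apply: Ga; first by rewrite /G /fmap /=; apply: filterS FB => b Bb; exists b.
  exact: open_nbhs_nbhs.
by exists b; split => //; exact: DC.
Qed.

Lemma continuous_sumr (R : realType) (T : topologicalType) (I : finType)
    (f : I -> T -> R) :
  (forall i, continuous (f i)) -> continuous (fun t => \sum_i f i t).
Proof.
move=> cf; apply: (@continuous_big R I +%R 0 xpredT) => [|i _]; last exact: cf.
exact: (@add_continuous R).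
Qed.

Section channels.
Variable R : realType.
Implicit Types X Y Z : finType.

(** Closed linear conditions cut this set out of the cube $[0,1]^{X \times Y}$, which is compact by
    Tychonoff. *)
Lemma compact_channel_set X Y : compact (@channel_set R X Y).
Proof.
have -> : @channel_set R X Y =
    [set f | forall p, `[0, 1]%classic (f p)] `&`
    \bigcap_x [set f | \sum_y f (x, y) = 1].
  apply/seteqP; split=> [f [f01 f1]|f [f01 f1]]; split=> //.
  - by case=> x y; rewrite /= in_itv /=.
  - by move=> x _; exact: f1.
  - by move=> x y; have := f01 (x, y); rewrite /= in_itv /=.
  - by move=> x; exact: f1.
apply: compact_closedI.
  apply: (@tychonoff _ (fun=> R) (fun=> `[0, 1]%classic)) => _.
  exact: segment_compact.
apply: closed_bigI => x _.
apply: (@preimage_closed _ _ (fun f : {ptws X * Y -> R} => \sum_y f (x, y))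
  [set r | r = 1]); last exact: closed_eq.
move=> f _; move: f.
apply: (@continuous_sumr R {ptws X * Y -> R} Y (fun y f => f (x, y))) => y.
exact: (@proj_continuous _ (fun=> R) (x, y)).
Qed.

Lemma compact_DMC X Y : compact [set: DMC R X Y].
Proof. exact/compact_set_type/compact_channel_set. Qed.

Lemma continuous_prob X Y y x : continuous (fun W : DMC R X Y => prob W y x).
Proof.
move=> W; apply: (@continuous_comp _ {ptws X * Y -> R} _ set_val
  (fun f => f (x, y))); first exact: initial_continuous.
exact: (@proj_continuous _ (fun=> R) (x, y)).
Qed.

(** Compared entry by entry, the graph is an intersection of zero sets of continuous functions. *)
Lemma closed_comp_graph X Y Z :
  closed [set p : DMC R X Z * DMC R X Y * DMC R Y Z |
          p.1.1 = dmc_comp p.2 p.1.2].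
Proof.
have -> : [set p : DMC R X Z * DMC R X Y * DMC R Y Z |
             p.1.1 = dmc_comp p.2 p.1.2] =
    \bigcap_(xz : X * Z) [set p | prob p.1.1 xz.2 xz.1 -
      \sum_y prob p.2 xz.2 y * prob p.1.2 y xz.1 = 0].
  apply/seteqP; split=> [p /= pE xz _ /=|p pE /=].
    by rewrite pE prob_comp subrr.
  apply: prob_inj => z x; apply/eqP; rewrite prob_comp -subr_eq0.
  exact/eqP/(pE (x, z)).
apply: closed_bigI => -[x z] _ /=.
apply: (@preimage_closed _ _ (fun p : DMC R X Z * DMC R X Y * DMC R Y Z =>
  prob p.1.1 z x - \sum_y prob p.2 z y * prob p.1.2 y x) [set r | r = 0]);
  last exact: closed_eq.
move=> p _; apply: cvgB.
  apply: (continuous_comp (f := fun q => q.1.1) (g := fun W => prob W z x)).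
    by apply: (continuous_comp (f := fst) (g := fst)); exact: cvg_fst.
  exact: continuous_prob.
move: p; apply: continuous_sumr => y p; apply: cvgM.
  apply: (continuous_comp (f := snd) (g := fun W => prob W z y)).
    exact: cvg_snd.
  exact: continuous_prob.
apply: (continuous_comp (f := fun q => q.1.2) (g := fun W => prob W y x)).
  apply: (continuous_comp (f := fst) (g := snd)); first exact: cvg_fst.
  exact: cvg_snd.
exact: continuous_prob.
Qed.

Lemma closed_degraded X Y Z :
  closed [set p : DMC R X Z * DMC R X Y | degraded p.1 p.2].
Proof.
have -> : [set p : DMC R X Z * DMC R X Y | degraded p.1 p.2] =
    fst @` [set p : DMC R X Z * DMC R X Y * DMC R Y Z |
            p.1.1 = dmc_comp p.2 p.1.2].
  apply/seteqP; split=> [p [V pV]|_ [[p V] pV <-]]; last by exists V.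
  by exists (p, V).
apply: closed_fst_image; [exact: compact_DMC|exact: closed_comp_graph].
Qed.

Lemma closed_equivalent X Y Z :
  closed [set p : DMC R X Y * DMC R X Z | equivalent p.1 p.2].
Proof.
apply: closedI; last exact: closed_degraded.
apply: (@preimage_closed _ _ (fun p : DMC R X Y * DMC R X Z => (p.2, p.1))
  [set p | degraded p.1 p.2]); last exact: closed_degraded.
by move=> p _; exact: swap_continuous.
Qed.

(** With output alphabets of sizes [n.+1] for [Y] and [m.+1] for [Z], this transfers closedness from
    the [m]-th piece to the [n]-th. *)
Lemma closed_equivalent_saturation X Y Z (F : set (DMC R X Z)) :
  closed F -> closed [set W : DMC R X Y | exists2 W', F W' & equivalent W W'].
Proof.
move=> cF.
have -> : [set W : DMC R X Y | exists2 W', F W' & equivalent W W'] =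
    fst @` ([set p : DMC R X Y * DMC R X Z | equivalent p.1 p.2] `&`
            snd @^-1` F).
  apply/seteqP; split=> [W [W' FW' e]|_ [[W W'] [e FW'] <-]].
    by exists (W, W').
  by exists W'.
apply: closed_fst_image; first exact: compact_DMC.
apply: closedI; first exact: closed_equivalent.
by apply: preimage_closed => // p _; exact: cvg_snd.
Qed.

End channels.

Section naturality.
Variables (R : realType) (X : finType).

Lemma DMCo_openE m (U : set (DMCo R X 'I_m.+1)) :
  open U = open (@DMCo_class R X 'I_m.+1 @^-1` U).
Proof. by []. Qed.

(** Openness in the quotient is openness of the preimage in the disjoint union, tested on each
    summand. *)
Lemma strong_openP (U : set (DMCso R X)) :
  opens (strong_topology R X) U <->
  forall m, open (@DMCso_class R X m @^-1` U).
Proof. exact: sigT_openP. Qed.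

Lemma subspace_opens_strong_sub m :
  subspace_opens (strong_topology R X) (DMCso_sub m) `<=`
  [set @DMCo_incl R X m @` U | U in open].
Proof.
move=> _ [U /strong_openP oU <-]; exists (@DMCo_incl R X m @^-1` U).
  rewrite /= DMCo_openE.
  have -> : @DMCo_class R X _ @^-1` (@DMCo_incl R X m @^-1` U) =
            @DMCso_class R X m @^-1` U.
    by apply/seteqP; split=> W /=; rewrite DMCo_inclE.
  exact: oU.
rewrite -DMCo_incl_range.
apply/seteqP; split=> [_ [c Uc <-]|d [Ud [c _ cd]]].
  by split=> //; exists c.
by exists c => //; rewrite /= cd.
Qed.

(** The image of [V] itself need not be strongly open; this larger set also contains every class
    outside the [m]-th piece. *)
Lemma open_strong_setC_image_DMCo_incl m (V : set (DMCo R X 'I_m.+1)) :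
  open V -> opens (strong_topology R X) (~` (@DMCo_incl R X m @` ~` V)).
Proof.
move=> oV; apply/strong_openP => n.
have -> : @DMCso_class R X n @^-1` (~` (@DMCo_incl R X m @` ~` V)) =
    ~` [set W | exists2 W', (~` (@DMCo_class R X _ @^-1` V)) W' &
                equivalent W W'].
  rewrite preimage_setC; congr (~` _).
  apply/seteqP; split=> [W [c Vc cE]|W [W' VW' e]].
    rewrite -(DMCo_class_repr c) in Vc cE.
    by eexists; first exact: Vc; apply/DMCso_classP; rewrite -cE DMCo_inclE.
  by exists (DMCo_class W') => //; rewrite DMCo_inclE; apply/esym/DMCso_classP.
apply/closed_openC/closed_equivalent_saturation/open_closedC.
by rewrite -DMCo_openE.
Qed.

Lemma strong_topology_natural : natural_topology (strong_topology R X).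
Proof.
move=> m; apply/seteqP; split; first exact: subspace_opens_strong_sub.
move=> _ [V oV <-]; eexists; first exact: open_strong_setC_image_DMCo_incl oV.
(* Within the [m]-th piece exactly the image of [V] remains: by injectivity of [DMCo_incl] it is
   disjoint from the image of the complement of [V]. *)
rewrite -DMCo_incl_range; apply/seteqP; split=> [d [nVd [c _ cd]]|_ [c Vc <-]].
  by exists c => //; apply: contrapT => nVc; apply: nVd; exists c.
by split; [case=> d nVd /DMCo_incl_inj dc; apply: nVd; rewrite dc|exists c].
Qed.

Lemma natural_sub_strong (T : Topological (DMCso R X)) :
  natural_topology T -> opens T `<=` opens (strong_topology R X).
Proof.
move=> nT U oU; apply/strong_openP => m.
have [V oV VU] : [set @DMCo_incl R X m @` V | V in open] (U `&` DMCso_sub m).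
  by rewrite -nT; exists U.
(* Classes of channels in [DMC R X 'I_m.+1] lie in [DMCso_sub m], so this preimage depends only on
   the trace of [U] there. *)
have -> : @DMCso_class R X m @^-1` U = @DMCo_class R X _ @^-1` V.
  apply/seteqP; split=> W /= UW.
    have [c Vc] : (@DMCo_incl R X m @` V) (DMCso_class W).
      by rewrite VU; split => //; exists W.
    by rewrite -DMCo_inclE => /DMCo_incl_inj <-.
  have [] // : (U `&` DMCso_sub m) (DMCso_class W).
  by rewrite -VU; exists (DMCo_class W) => //; exact: DMCo_inclE.
by rewrite -DMCo_openE.
Qed.

End naturality.

Theorem mainTheorem6 (R : realType) (X : finType) (hX : (0 < #|X|)%N) :
  natural_topology (strong_topology R X) /\
  (forall T : Topological (DMCso R X),
     natural_topology T -> opens T `<=` opens (strong_topology R X)).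
Proof.
by split; [exact: strong_topology_natural|exact: natural_sub_strong].
Qed.
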